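(* There exists a constant $c>0$ such that the following holds. Let $X \subseteq \mathbb{R}^d$ be a set of $n$ points, let $k \ge 1$ be an integer and let $0 \le \varepsilon < 1/2$. Let $C$ be the set of $k$ centers output by the $(1+\varepsilon)$-noisy $k$-means++ algorithm (defined in the context) run on $X$ and $k$ against an arbitrary adversary. Then \[ \mathbb{E}[\phi(X,C)] \le c\,(1+\log k)\cdot \mathrm{OPT}_k(X), \] i.e. the $(1+\varepsilon)$-noisy $k$-means++ algorithm is $O(\log k)$-approximate in expectation for the $k$-means problem.
   Context: For a point $x\in\mathbb{R}^d$ and a finite set $C\subseteq \mathbb{R}^d$, $\phi(x,C)=\min_{c\in C}\|x-c\|^2$, and for a finite set $X$, $\phi(X,C)=\sum_{x\in X}\phi(x,C)$. The $k$-means problem asks for a set $C$ of at most $k$ centers minimizing $\phi(X,C)$; $\mathrm{OPT}_k(X)$ denotes the minimum value. The $(1+\varepsilon)$-noisy $k$-means++ algorithm, with input $X$, $k$ and $0\le \varepsilon<1/2$, works as follows. First, a point $x\in X$ is sampled from a distribution in which each point $x$ has probability in $[(1-\varepsilon)\frac1n,(1+\varepsilon)\frac1n]$, and $C_1=\{x\}$. Then, for $i=1,\dots,k-1$, given the current center set $C_i$, a point $x\in X$ is sampled from a distribution in which each point $x$ has probability in $\left[(1-\varepsilon)\frac{\phi(x,C_i)}{\phi(X,C_i)},(1+\varepsilon)\frac{\phi(x,C_i)}{\phi(X,C_i)}\right]$, and $C_{i+1}=C_i\cup\{x\}$. The output is $C=C_k$. In each step the actual sampling distribution is chosen by an adversary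 (possibly depending on everything that happened so far) subject only to these multiplicative constraints. With $\varepsilon=0$ this is the classical $k$-means++ algorithm. *)

(* Defs.v *)
From HB Require Import structures.
From mathcomp Require Import all_boot all_order all_algebra.
From mathcomp Require Import all_classical all_reals.
From mathcomp Require Import exp Rstruct.

Set Implicit Arguments.
Unset Strict Implicit.
Unset Printing Implicit Defensive.

Import Order.TTheory GRing.Theory Num.Theory.
Local Open Scope ring_scope.

Notation RR := Rdefinitions.R.

Definition sqdist (d : nat) (a b : 'rV[RR]_d) : RR :=
  \sum_(i < d) (a ord0 i - b ord0 i) ^+ 2.

(* phi(a, C) = min_{c in C} ||a - c||^2 ; C is a finite (nonempty) list of
   centers.  The empty case is never used (value 0 by convention). *)
Definition phi_pt (d : nat) (a : 'rV[RR]_d) (C : seq 'rV[RR]_d) : RR :=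
  match C with
  | [::] => 0
  | c :: C' => \big[Num.min/sqdist a c]_(c' <- C') sqdist a c'
  end.

Definition phi_set (d n : nat) (x : 'I_n -> 'rV[RR]_d) (C : seq 'rV[RR]_d) : RR :=
  \sum_(j < n) phi_pt (x j) C.

Local Open Scope classical_set_scope.
Definition OPT (d n : nat) (x : 'I_n -> 'rV[RR]_d) (k : nat) : RR :=
  inf [set r : RR | exists C : seq 'rV[RR]_d,
         [/\ ltn 0 (size C), leq (size C) k & r = phi_set x C]].

(* A history is the sequence of indices of the points sampled so far;
   the current center set is the image of the history. *)
Definition centers (d n : nat) (x : 'I_n -> 'rV[RR]_d) (h : seq 'I_n)
  : seq 'rV[RR]_d := map x h.

Definition is_distr (n : nat) (q : 'I_n -> RR) : Prop :=
  (forall j, 0 <= q j) /\ \sum_(j < n) q j = 1.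

(* An adaptive adversary: given the history, it chooses the sampling
   distribution for the next point.  It is admissible for the
   (1+eps)-noisy k-means++ algorithm if, at every step i = 0..k-1
   (history of length i), the chosen distribution satisfies the
   multiplicative constraints.  For i >= 1 the constraint
   p(j) in [(1-eps) phi(x_j,C)/phi(X,C), (1+eps) phi(x_j,C)/phi(X,C)]
   is written multiplied through by phi(X,C). *)
Definition admissible (d n : nat) (x : 'I_n -> 'rV[RR]_d) (k : nat) (eps : RR)
  (p : seq 'I_n -> 'I_n -> RR) : Prop :=
  forall h : seq 'I_n, (size h < k)%N ->
    is_distr (p h) /\
    (if h is [::] then
       forall j, (1 - eps) / n%:R <= p h j <= (1 + eps) / n%:R
     else
       forall j, (1 - eps) * phi_pt (x j) (centers x h)
                   <= p h j * phi_set x (centers x h)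
                   <= (1 + eps) * phi_pt (x j) (centers x h)).

Fixpoint exp_cost (d n : nat) (x : 'I_n -> 'rV[RR]_d)
  (p : seq 'I_n -> 'I_n -> RR) (m : nat) (h : seq 'I_n) : RR :=
  match m with
  | O => phi_set x (centers x h)
  | m'.+1 => \sum_(j < n) p h j * exp_cost x p m' (rcons h j)
  end.

(* Main.v *)
(* Fix any centres C with at most k points and split X into clusters by nearest
   centre; a cluster is covered once one of its points has been sampled. By the
   D^2-sampling lemma a cluster is covered at expected cost O(its cost for C), so
   covered clusters cost O(phi(X, C)) in expectation at all times. A sample is
   wasted if it falls into a covered cluster; the final cost of the uncovered
   clusters is at most the number of wasted samples times the final average cost
   of an uncovered cluster. The noise can make this average grow, but only by a
   constant factor in expectation: given the present average theta, the ratio of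
   the total excess over 6 theta to the number of surviving clusters of cost at
   most 2 theta is a supermartingale. Thus a waste with m steps left contributes
   in expectation O(covered cost / m), and these sum to O(log k) phi(X, C). *)
Require Import Defs.
From HB Require Import structures.
From mathcomp Require Import all_boot all_order all_algebra.
From mathcomp Require Import all_classical all_reals.
From mathcomp Require Import exp Rstruct.
From mathcomp Require Import ring lra.
Set Implicit Arguments.
Unset Strict Implicit.
Unset Printing Implicit Defensive.

Import Order.TTheory GRing.Theory Num.Theory.
Local Open Scope ring_scope.

(** * Squared distances and sampling within one cluster *)

Section Distance.
Context (d : nat).
Implicit Types (a b c : 'rV[RR]_d) (C : seq 'rV[RR]_d).

Lemma sqdist_ge0 a b : 0 <= sqdist a b.
Proof. by apply: sumr_ge0 => i _; apply: sqr_ge0. Qed.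

Lemma sqdist_sym a b : sqdist a b = sqdist b a.
Proof. by apply: eq_bigr => i _; rewrite -[LHS]sqrrN opprB. Qed.

Lemma sqdist_triangle a b c : sqdist a c <= 2 * sqdist a b + 2 * sqdist b c.
Proof.
rewrite /sqdist !mulr_sumr -big_split /=; apply: ler_sum => i _.
set u := a _ _; set v := b _ _; set w := c _ _.
have := sqr_ge0 (u - 2 * v + w); rewrite !expr2; nra.
Qed.

Lemma phi_pt_le a c C : c \in C -> phi_pt a C <= sqdist a c.
Proof.
case: C => [//|c0 C] /=; rewrite inE => /orP[/eqP->|cC].
  exact: bigmin_le_id.
exact: (ge_bigmin_seq _ _ xpredT).
Qed.

Lemma phi_pt_attained a C : C != [::] -> exists2 c, c \in C & phi_pt a C = sqdist a c.
Proof.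
case: C => [//|c0 C] _ /=.
elim: C => [|c1 C [c cC IH]]; first by exists c0; rewrite ?big_nil ?inE.
rewrite big_cons IH minEle; case: ifP => _; first by exists c1; rewrite ?inE ?eqxx ?orbT.
by exists c => //; move: cC; rewrite !inE => /orP[->|->]; rewrite ?orbT.
Qed.

Lemma phi_pt_ge0 a C : 0 <= phi_pt a C.
Proof.
have [->//|/phi_pt_attained - /(_ a) [c _ ->]] := eqVneq C [::].
exact: sqdist_ge0.
Qed.

Lemma phi_pt_subset a C C' : C != [::] -> {subset C <= C'} -> phi_pt a C' <= phi_pt a C.
Proof. by move=> /phi_pt_attained - /(_ a) [c cC ->] CC'; apply/phi_pt_le/CC'. Qed.

Lemma phi_pt_triangle a b C : phi_pt a C <= 2 * phi_pt b C + 2 * sqdist a b.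
Proof.
have [->|/phi_pt_attained - /(_ b) [c cC ->]] := eqVneq C [::].
  by have := sqdist_ge0 a b; rewrite /=; lra.
apply: le_trans (phi_pt_le a cC) _; rewrite addrC; exact: sqdist_triangle.
Qed.

Context (I : finType) (A : pred I) (y : I -> 'rV[RR]_d).

(** Divided by [#|A|], the left side is the expected cost of [A] around a uniformly drawn point of
    [A]. Passing through [c] gives the factor 4, where the centroid identity would give 2. *)
Lemma sum_sqdist_pairs c :
  \sum_(i | A i) \sum_(j | A j) sqdist (y j) (y i)
    <= 4 * #|A|%:R * \sum_(i | A i) sqdist (y i) c.
Proof.
apply: (@le_trans _ _ (\sum_(i | A i) \sum_(j | A j)
                         (2 * sqdist (y j) c + 2 * sqdist (y i) c))).
  apply: ler_sum => i _; apply: ler_sum => j _.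
  by rewrite [sqdist (y i) c]sqdist_sym; exact: sqdist_triangle.
under eq_bigr do rewrite big_split /= -mulr_sumr sumr_const.
rewrite big_split /= sumr_const sumrMnl -mulr_sumr -(mulr_natl _ #|A|).
lra.
Qed.

(* The D^2-sampling lemma, cleared of the normalisation by the total cost; an
   arbitrary c stands for the optimal centre, so centroids are never needed. *)
Lemma D2_sampling c C (D := fun i => phi_pt (y i) C) :
  \sum_(i | A i) D i * (\sum_(j | A j) Num.min (D j) (sqdist (y j) (y i)))
    <= 16 * (\sum_(i | A i) sqdist (y i) c) * \sum_(i | A i) D i.
Proof.
have D0 i : 0 <= D i by exact: phi_pt_ge0.
have [i0 Ai0|A0] := pickP A; last by rewrite !big_pred0 // mulr0.
have A_gt0 : 0 < #|A|%:R :> RR by rewrite ltr0n; apply/card_gt0P; exists i0.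
set S := \sum_(i | A i) D i; set O := \sum_(i | A i) sqdist (y i) c.
pose s i := \sum_(j | A j) sqdist (y j) (y i).
have S0 : 0 <= S by exact: sumr_ge0.
rewrite -(ler_pM2l A_gt0) mulr_sumr.
apply: (@le_trans _ _ (\sum_(i | A i) 4 * S * s i)); last first.
  rewrite -mulr_sumr; have := sum_sqdist_pairs c; rewrite -/O => H.
  by have := ler_wpM2l S0 H; rewrite /s; lra.
apply: ler_sum => i _; rewrite mulrA.
(* The triangle inequality summed over all [j] in [A]. *)
have DA : #|A|%:R * D i <= 2 * S + 2 * s i.
  rewrite mulr_natl -sumr_const /S /s !mulr_sumr -big_split /=.
  by apply: ler_sum => j _; rewrite [sqdist (y j) _]sqdist_sym; exact: phi_pt_triangle.
set mn := \sum_(j | A j) _.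
have mn0 : 0 <= mn by apply: sumr_ge0 => j _; rewrite le_min D0 sqdist_ge0.
(* In [(2 * S + 2 * s i) * mn], [mn] is bounded by [s i] against [S] and by [S] against [s i],
   giving [4 * S * s i]. *)
have mnS : mn <= S by apply: ler_sum => j _; rewrite ge_min lexx.
have mns : mn <= s i by apply: ler_sum => j _; rewrite ge_min lexx orbT.
nra.
Qed.

End Distance.

(** * The sampling process and its cluster costs *)

Section Process.
Context (d n K k : nat) (x : 'I_n -> 'rV[RR]_d) (ctr : 'I_K -> 'rV[RR]_d).
Context (lab : 'I_n -> 'I_K) (p : seq 'I_n -> 'I_n -> RR).
Implicit Types (h : seq 'I_n) (j : 'I_n) (l : 'I_K) (m : nat) (f g : seq 'I_n -> RR).

Fixpoint expect m f h : RR :=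
  if m is m'.+1 then \sum_j p h j * expect m' f (rcons h j) else f h.

Definition cost h j := phi_pt (x j) (centers x h).
Definition total h := phi_set x (centers x h).
Definition uncovered h := [set l | l \notin map lab h].
Definition cl_cost h l := \sum_(j | lab j == l) cost h j.
Definition mass h l := \sum_(j | lab j == l) p h j.
Definition ref_cost l := \sum_(j | lab j == l) sqdist (x j) (ctr l).
Definition ucost h := \sum_(l in uncovered h) cl_cost h l.
Definition ccost h := \sum_(l | l \notin uncovered h) cl_cost h l.
(** Equals 0 when no cluster is uncovered, since division by 0 gives 0. *)
Definition avg h := ucost h / #|uncovered h|%:R.
(** An uncovered cluster is charged in advance for its expected cost when hit: 48 = 3 * 16, with
    noise ratio 3 and the constant 16 of [D2_sampling]. *)
Definition pot h := ccost h + 48 * \sum_(l in uncovered h) ref_cost l.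

Lemma exp_costE m h : exp_cost x p m h = expect m total h.
Proof. by elim: m h => [//|m IH] h /=; apply: eq_bigr => j _; rewrite IH. Qed.

Lemma expect_affine m a b f h :
  (forall h, (size h < k)%N -> \sum_j p h j = 1) -> (size h + m <= k)%N ->
  expect m (fun h => a + b * f h) h = a + b * expect m f h.
Proof.
move=> p1; elim: m h => [//|m IH] h /= hm.
have hk : (size h < k)%N by apply: leq_trans hm; rewrite addnS ltnS leq_addr.
rewrite (eq_bigr (fun j => p h j * a + b * (p h j * expect m f (rcons h j)))).
  by rewrite big_split /= -mulr_suml p1 // mul1r -mulr_sumr.
by move=> j _; rewrite IH ?size_rcons ?addSnnS //; ring.
Qed.

Context (p_ge0 : forall h j, (size h < k)%N -> 0 <= p h j).
Context (p_sum1 : forall h, (size h < k)%N -> \sum_j p h j = 1).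

Lemma expect_le m f g h : (forall h, f h <= g h) -> (size h + m <= k)%N ->
  expect m f h <= expect m g h.
Proof.
move=> fg; elim: m h => [//|m IH] h /= hm.
have hk : (size h < k)%N by apply: leq_trans hm; rewrite addnS ltnS leq_addr.
by apply: ler_sum => j _; rewrite ler_wpM2l ?p_ge0 ?IH ?size_rcons ?addSnnS.
Qed.

(** The invariant [I] excludes histories where the step inequality may fail, such as the empty
    one. *)
Lemma expect_supermartingale (I : seq 'I_n -> Prop) m f h :
  (forall h j, I h -> I (rcons h j)) ->
  (forall h, I h -> (size h < k)%N -> \sum_j p h j * f (rcons h j) <= f h) ->
  I h -> (size h + m <= k)%N -> expect m f h <= f h.
Proof.
move=> Ir fI; elim: m h => [//|m IH] h /= Ih hm.
have hk : (size h < k)%N by apply: leq_trans hm; rewrite addnS ltnS leq_addr.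
apply: le_trans (fI _ Ih hk); apply: ler_sum => j _.
by rewrite ler_wpM2l ?p_ge0 ?IH ?size_rcons ?addSnnS //; exact: Ir.
Qed.

Lemma weighted_le h f b : (size h < k)%N -> (forall j, f (rcons h j) <= b) ->
  \sum_j p h j * f (rcons h j) <= b.
Proof.
move=> hk fb; rewrite -[b]mul1r -(p_sum1 hk) mulr_suml.
by apply: ler_sum => j _; rewrite ler_wpM2l ?p_ge0.
Qed.

Lemma sum_by_cluster h (F : 'I_K -> RR) :
  \sum_j p h j * F (lab j) = \sum_l mass h l * F l.
Proof.
rewrite (partition_big lab xpredT) //=; apply: eq_bigr => l _.
by rewrite /mass mulr_suml; apply: eq_bigr => j /eqP->.
Qed.

Lemma sum_mass h : (size h < k)%N -> \sum_l mass h l = 1.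
Proof.
move=> hk; rewrite -(p_sum1 hk) (partition_big lab xpredT) //=.
Qed.

Lemma mass_ge0 h l : (size h < k)%N -> 0 <= mass h l.
Proof. by move=> hk; apply: sumr_ge0 => j _; exact: p_ge0. Qed.

Lemma cost_ge0 h j : 0 <= cost h j. Proof. exact: phi_pt_ge0. Qed.

Lemma cl_cost_ge0 h l : 0 <= cl_cost h l.
Proof. by apply: sumr_ge0 => j _; exact: cost_ge0. Qed.

Lemma ucost_ge0 h : 0 <= ucost h.
Proof. by apply: sumr_ge0 => l _; exact: cl_cost_ge0. Qed.

Lemma ccost_ge0 h : 0 <= ccost h.
Proof. by apply: sumr_ge0 => l _; exact: cl_cost_ge0. Qed.

Lemma ref_cost_ge0 l : 0 <= ref_cost l.
Proof. by apply: sumr_ge0 => j _; exact: sqdist_ge0. Qed.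

Lemma ccost_le_pot h : ccost h <= pot h.
Proof.
rewrite /pot lerDl mulr_ge0 //; apply: sumr_ge0 => l _; exact: ref_cost_ge0.
Qed.

Lemma totalE h : total h = ucost h + ccost h.
Proof.
rewrite /total /phi_set (partition_big lab xpredT) //= -/(cl_cost h _).
by rewrite (bigID (mem (uncovered h))).
Qed.

Lemma cost_rcons h i j : h != [::] -> cost (rcons h i) j <= cost h j.
Proof.
move=> h0; apply: phi_pt_subset => [|c]; first by rewrite -size_eq0 size_map size_eq0.
by rewrite /centers map_rcons mem_rcons inE => ->; rewrite orbT.
Qed.

Lemma cost_rcons_sqdist h i j : cost (rcons h i) j <= sqdist (x j) (x i).
Proof. by apply: phi_pt_le; rewrite /centers map_rcons mem_rcons inE eqxx. Qed.

Lemma cl_cost_rcons h i l : h != [::] -> cl_cost (rcons h i) l <= cl_cost h l.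
Proof. by move=> h0; apply: ler_sum => j _; exact: cost_rcons. Qed.

Lemma uncovered_rcons h j : uncovered (rcons h j) = uncovered h :\ lab j.
Proof. by apply/setP=> l; rewrite !inE map_rcons mem_rcons inE negb_or. Qed.

Lemma sum_uncovered_rcons h j (F : 'I_K -> RR) :
  \sum_(l in uncovered (rcons h j)) F l
  = \sum_(l in uncovered h) F l - (if lab j \in uncovered h then F (lab j) else 0).
Proof.
rewrite uncovered_rcons; case: ifP => hj.
  by rewrite [in RHS](big_setD1 _ hj) /= addrAC subrr add0r.
rewrite subr0; apply: eq_bigl => l; rewrite !inE.
by case: eqVneq => // ->; move: hj; rewrite !inE => ->.
Qed.

Lemma ucost_rcons h j : h != [::] ->
  ucost (rcons h j)
  <= ucost h - (if lab j \in uncovered h then cl_cost h (lab j) else 0).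
Proof.
by move=> h0; rewrite -sum_uncovered_rcons; apply: ler_sum => l _; exact: cl_cost_rcons.
Qed.

(** * The potential is a supermartingale *)

Lemma pot_rcons h j :
  pot (rcons h j) <= pot h + (if lab j \in uncovered h
                              then cl_cost (rcons h j) (lab j) - 48 * ref_cost (lab j)
                              else 0).
Proof.
rewrite /pot sum_uncovered_rcons.
(* A covered cluster shows that [h] is nonempty, so costs can only drop; the first sample is thus
   included. *)
have E l : l \notin uncovered h -> cl_cost (rcons h j) l <= cl_cost h l.
  by rewrite inE negbK => lh; apply: cl_cost_rcons; case: (h) lh.
have [hj|hj] := boolP (lab j \in uncovered h).
  have -> : ccost (rcons h j) = cl_cost (rcons h j) (lab j)
              + \sum_(l | l \notin uncovered h) cl_cost (rcons h j) l.
    rewrite /ccost (bigD1 (lab j)) /=; last by rewrite uncovered_rcons !inE eqxx.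
    congr (_ + _); apply: eq_bigl => l; rewrite uncovered_rcons !inE negb_and !negbK.
    by case: eqVneq => [->|]; rewrite ?andbT ?andbF //=; move: hj; rewrite inE => /negbTE.
  have : \sum_(l | l \notin uncovered h) cl_cost (rcons h j) l <= ccost h by apply: ler_sum.
  lra.
have -> : ccost (rcons h j) = \sum_(l | l \notin uncovered h) cl_cost (rcons h j) l.
  apply: eq_bigl => l; rewrite uncovered_rcons !inE negb_and !negbK.
  by case: eqVneq => // ->; move: hj; rewrite inE negbK => ->.
by rewrite subr0 addr0 lerD2r; apply: ler_sum.
Qed.

(** Only a hit on an uncovered cluster can raise [pot], so the drift is checked cluster by cluster.
    This serves both the first draw and the later ones. *)
Lemma pot_step_of_clusters h : (size h < k)%N ->
  (forall l, l \in uncovered h ->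
     \sum_(j | lab j == l) p h j * cl_cost (rcons h j) l <= 48 * ref_cost l * mass h l) ->
  \sum_j p h j * pot (rcons h j) <= pot h.
Proof.
move=> hk H.
apply: (@le_trans _ _ (\sum_j p h j * (pot h + (if lab j \in uncovered h
             then cl_cost (rcons h j) (lab j) - 48 * ref_cost (lab j) else 0)))).
  by apply: ler_sum => j _; rewrite ler_wpM2l ?p_ge0 ?pot_rcons.
under eq_bigr do rewrite mulrDr.
rewrite big_split /= -mulr_suml p_sum1 // mul1r gerDl.
rewrite (partition_big lab xpredT) //=; apply: sumr_le0 => l _.
have [lh|lh] := boolP (l \in uncovered h); last first.
  by rewrite big1 // => j /eqP->; rewrite (negbTE lh) mulr0.
rewrite (eq_bigr (fun j => p h j * cl_cost (rcons h j) l - 48 * ref_cost l * p h j)).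
  by rewrite sumrB -mulr_sumr subr_le0; exact: H.
by move=> j /eqP->; rewrite lh; ring.
Qed.

(* The witness is [lam = 1 / (2 * total h)], the scale at which all sampling
   probabilities lie between once and three times the cost. *)
Context (p_noise : forall h, h != [::] -> (size h < k)%N -> total h != 0 ->
  exists2 lam, 0 <= lam /\ lam * total h = 1 / 2
             & forall j, lam * cost h j <= p h j <= 3 * lam * cost h j).

Lemma mass_noise h : h != [::] -> (size h < k)%N -> total h != 0 ->
  exists2 lam, 0 <= lam /\ lam * total h = 1 / 2
             & forall l, lam * cl_cost h l <= mass h l <= 3 * lam * cl_cost h l.
Proof.
move=> h0 hk /(p_noise h0 hk)[lam lamP pP]; exists lam => // l.
by rewrite !mulr_sumr; apply/andP; split; apply: ler_sum => j _;
   have /andP[] := pP j.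
Qed.

Lemma total_eq0 h : total h = 0 -> ucost h = 0 /\ forall l, cl_cost h l = 0.
Proof.
move=> t0; have H l : cl_cost h l = 0.
  apply/eqP; rewrite eq_le cl_cost_ge0 andbT -t0 /total /phi_set.
  rewrite (bigID (fun j => lab j == l)) /= lerDl.
  by apply: sumr_ge0 => j _; exact: cost_ge0.
by split=> //; rewrite /ucost big1.
Qed.

Lemma pot_step h : h != [::] -> (size h < k)%N ->
  \sum_j p h j * pot (rcons h j) <= pot h.
Proof.
move=> h0 hk; apply: pot_step_of_clusters => // l _.
(* At total cost 0 the noise bound gives no information on [p], but all costs are 0 and remain
   so. *)
have [t0|t0] := eqVneq (total h) 0.
  apply: (@le_trans _ _ 0); last by rewrite !mulr_ge0 ?ref_cost_ge0 ?mass_ge0.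
  apply: sumr_le0 => j _; rewrite mulr_ge0_le0 ?p_ge0 //.
  by rewrite -((total_eq0 t0).2 l); exact: cl_cost_rcons.
have [lam [lam0 lamt] pP] := p_noise h0 hk t0.
have mP : lam * cl_cost h l <= mass h l.
  by rewrite mulr_sumr; apply: ler_sum => j _; have /andP[] := pP j.
apply: (@le_trans _ _ (48 * ref_cost l * (lam * cl_cost h l))); last first.
  by rewrite ler_wpM2l // mulr_ge0 ?ref_cost_ge0.
have H := D2_sampling [pred j | lab j == l] x (ctr l) (centers x h).
apply: (@le_trans _ _ (3 * lam * \sum_(j | lab j == l) cost h j *
          \sum_(i | lab i == l) Num.min (cost h i) (sqdist (x i) (x j)))).
  rewrite mulr_sumr; apply: ler_sum => j _; rewrite mulrA.
  have /andP[_ pj] := pP j.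
  apply: ler_pM; rewrite ?p_ge0 ?cl_cost_ge0 //; apply: ler_sum => i _.
  by rewrite le_min cost_rcons // cost_rcons_sqdist.
have := ler_wpM2l (mulr_ge0 (ler0n RR 3) lam0) H; rewrite /= /ref_cost /cl_cost.
rewrite /cost; lra.
Qed.

Context (p_first : forall j, 1 / 2 / n%:R <= p [::] j <= 3 / 2 / n%:R).

(** The first draw is uniform up to a factor 3, so [sum_sqdist_pairs] replaces [D2_sampling]; 12 = 3
    * 4 would do in place of 48. *)
Lemma pot_first_step : (0 < k)%N -> \sum_j p [::] j * pot [:: j] <= pot [::].
Proof.
move=> k0; apply: pot_step_of_clusters => // l _.
pose A := [pred j | lab j == l].
set c := #|A|%:R / n%:R : RR.
have mP : c / 2 <= mass [::] l.
  apply: (@le_trans _ _ (\sum_(j in A) 1 / 2 / n%:R)).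
    by rewrite sumr_const -mulr_natl /c; lra.
  by apply: ler_sum => j _; have /andP[] := p_first j.
apply: (@le_trans _ _ (48 * ref_cost l * (c / 2))); last first.
  by rewrite ler_wpM2l // mulr_ge0 ?ref_cost_ge0.
apply: (@le_trans _ _ (3 / 2 / n%:R * \sum_(j | A j) \sum_(i | A i) sqdist (x i) (x j))).
  rewrite mulr_sumr; apply: ler_sum => j _.
  have /andP[_ pj] := p_first j.
  apply: ler_pM; rewrite ?p_ge0 ?cl_cost_ge0 //; apply: ler_sum => i _.
  exact: cost_rcons_sqdist.
have n0 : 0 <= 3 / 2 / n%:R :> RR by rewrite !divr_ge0 ?ler0n.
have := ler_wpM2l n0 (sum_sqdist_pairs A x (ctr l)).
have r0 := ref_cost_ge0 l.
have c0 : 0 <= c by rewrite divr_ge0 ?ler0n.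
move=> /le_trans; apply.
rewrite -/(ref_cost l) (_ : 3 / 2 / n%:R * _ = 6 * (c * ref_cost l)); last first.
  by rewrite /c; move: (n%:R^-1) => v; field.
have := mulr_ge0 c0 r0; lra.
Qed.


(** * Growth of the average uncovered cost *)

Section Excess.
Context (theta : RR) (B : {set 'I_K}).
Context (theta_ge0 : 0 <= theta).

Let g h l := Num.max (cl_cost h l - 6 * theta) 0.
Let excess h := \sum_(l in uncovered h) g h l.
(* [B] is a family of clusters that cost at most [2 * theta] when it is chosen,
   hence ever after. *)
Let cheap h := uncovered h :&: B.
(** The [+ 1] keeps the denominator positive after the last cheap cluster is hit. *)
Definition excess_ratio h := excess h / (#|cheap h|%:R + 1).

Let g_ge0 h l : 0 <= g h l. Proof. by rewrite le_max lexx orbT. Qed.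
Let excess_ge0 h : 0 <= excess h. Proof. exact: sumr_ge0. Qed.
Let Dpos h : 0 < #|cheap h|%:R + 1 :> RR. Proof. by rewrite ltr_wpDl ?ler0n. Qed.

Let excess_rcons h j : h != [::] ->
  excess (rcons h j) <= excess h - (if lab j \in uncovered h then g h (lab j) else 0).
Proof.
move=> h0; rewrite -sum_uncovered_rcons; apply: ler_sum => l _.
by rewrite /g ge_max !le_max lexx orbT andbT lerB // cl_cost_rcons.
Qed.

Let cheap_rcons h j : #|cheap h| = ((lab j \in cheap h) + #|cheap (rcons h j)|)%N.
Proof.
by rewrite (cardsD1 (lab j)) /cheap uncovered_rcons finset.setIDAC.
Qed.

(** With excess E and N cheap clusters, a cheap hit turns E/(N+1) into at most E/N, a gain of
    E/(N(N+1)). Any other uncovered hit removes its own excess from E; cheap clusters have none. *)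
Let excess_ratio_rcons h j : h != [::] ->
  (lab j \in cheap h -> cl_cost h (lab j) <= 2 * theta) ->
  excess_ratio (rcons h j) <= excess_ratio h
    + (if lab j \in cheap h then excess h / #|cheap h|%:R / (#|cheap h|%:R + 1) else 0)
    - (if lab j \in uncovered h then g h (lab j) / (#|cheap h|%:R + 1) else 0).
Proof.
move=> h0 small; have := excess_rcons j h0.
have := cheap_rcons h j; rewrite /excess_ratio.
have [lB|lB] := boolP (lab j \in cheap h) => /= cE; last first.
  have iD : 0 <= (#|cheap h|%:R + 1)^-1 :> RR by rewrite invr_ge0 ltW.
  have -> : #|cheap (rcons h j)| = #|cheap h| by rewrite [RHS]cE add0n.
  move=> /(ler_wpM2r iD)/le_trans; apply.
  by rewrite mulrBl addr0; case: ifP; rewrite ?mul0r.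
have lU : lab j \in uncovered h by case/finset.setIP: lB.
have g0 : g h (lab j) = 0.
  by apply/max_idPr; rewrite subr_le0; apply: le_trans (small lB) _; move: theta_ge0; lra.
rewrite lU g0 !subr0 mul0r subr0 => H.
have N0 : 0 < #|cheap h|%:R :> RR by rewrite ltr0n cE.
have -> : #|cheap (rcons h j)|%:R + 1 = #|cheap h|%:R :> RR by rewrite cE natrD addrC.
have -> : excess h / (#|cheap h|%:R + 1) + excess h / #|cheap h|%:R / (#|cheap h|%:R + 1)
          = excess h / #|cheap h|%:R.
  by field; rewrite gt_eqF ?Dpos // gt_eqF.
by rewrite ler_pM2r ?invr_gt0.
Qed.

(* A cluster with positive excess costs at least three times as much as a cheap
   one (2 theta), so, despite the noise, its removal is at least as likely as
   that of any given cheap cluster. *)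
Lemma excess_ratio_step h : h != [::] -> (size h < k)%N ->
  (forall l, l \in uncovered h :&: B -> cl_cost h l <= 2 * theta) ->
  \sum_j p h j * excess_ratio (rcons h j) <= excess_ratio h.
Proof.
move=> h0 hk small.
set D : RR := #|cheap h|%:R + 1; set e := excess h / #|cheap h|%:R / D.
have D0 : 0 < D by exact: Dpos.
have e0 : 0 <= e by rewrite !divr_ge0 // ltW.
have [t0|t0] := eqVneq (total h) 0.
  have [_ c0] := total_eq0 t0.
  have E0 h' : (forall l, cl_cost h' l <= 0) -> excess_ratio h' = 0.
    move=> c'; rewrite /excess_ratio /excess big1 ?mul0r // => l _.
    by apply/max_idPr; have := c' l; move: theta_ge0; lra.
  rewrite (E0 h) => [|l]; last by rewrite c0.
  apply: weighted_le => // j; rewrite (E0 (rcons h j)) // => l.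
  by rewrite -(c0 l); exact: cl_cost_rcons.
have [lam [lam0 lamt] mP] := mass_noise h0 hk t0.
pose F l := excess_ratio h + (if l \in cheap h then e else 0)
                 - (if l \in uncovered h then g h l / D else 0).
apply: (@le_trans _ _ (\sum_j p h j * F (lab j))).
  apply: ler_sum => j _; rewrite ler_wpM2l ?p_ge0 //.
  by apply: excess_ratio_rcons => // /small.
rewrite sum_by_cluster /F.
under eq_bigr do rewrite mulrBr mulrDr.
rewrite sumrB big_split /= -mulr_suml sum_mass // mul1r -addrA gerDl subr_le0.
(* [6 * lam * theta] bounds the mass of a cheap cluster from above and that of a cluster with
   positive excess from below, so it separates expected gain from expected loss. *)
apply: (@le_trans _ _ (6 * lam * theta * (excess h / D))).
  rewrite (eq_bigr (fun l => if l \in cheap h then mass h l * e else 0)); last first.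
    by move=> l _; case: ifP => // _; rewrite mulr0.
  rewrite -big_mkcond /=.
  apply: (@le_trans _ _ (\sum_(l in cheap h) 6 * lam * theta * e)).
    apply: ler_sum => l lB; rewrite ler_wpM2r //.
    have /andP[_ H] := mP l; apply: le_trans H _.
    have := ler_wpM2l lam0 (small l lB); lra.
  rewrite sumr_const -mulrnAr ler_wpM2l ?mulr_ge0 //.
  rewrite /e -mulrnAl -mulr_natr; have [->|c0] := eqVneq #|cheap h| 0%N.
    by rewrite mulr0 mul0r divr_ge0 // ltW.
  by rewrite divfK // pnatr_eq0.
rewrite (eq_bigr (fun l => if l \in uncovered h then mass h l * (g h l / D) else 0)); last first.
  by move=> l _; case: ifP => // _; rewrite mulr0.
rewrite -big_mkcond /= /excess mulr_suml mulr_sumr; apply: ler_sum => l _.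
rewrite !mulrA ler_pM2r ?invr_gt0 //.
have [cl|cl] := lerP (cl_cost h l - 6 * theta) 0.
  by rewrite /g (max_idPr cl) !mulr0.
rewrite ler_wpM2r //; have /andP[H _] := mP l; apply: le_trans H.
have := ler_wpM2l lam0 (ltW cl); lra.
Qed.

(** The factor 2 comes from [#|cheap h| + 1 <= 2 * #|uncovered h|], valid once some cluster is
    uncovered. *)
Lemma avg_le_excess_ratio h : avg h <= 6 * theta + 2 * excess_ratio h.
Proof.
rewrite /avg; have [u0|u0] := eqVneq #|uncovered h| 0%N.
  rewrite u0 invr0 mulr0 addr_ge0 ?mulr_ge0 //.
  by rewrite invr_ge0 ltW.
have u1 : 0 < #|uncovered h|%:R :> RR by rewrite ltr0n lt0n.
rewrite ler_pdivrMr //.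
have H : ucost h <= 6 * theta * #|uncovered h|%:R + excess h.
  rewrite mulr_natr -sumr_const -big_split /=; apply: ler_sum => l _.
  by rewrite -lerBlDl le_max lexx.
apply: le_trans H _; rewrite (mulrDl (6 * theta)) lerD2l /excess_ratio.
rewrite -mulrA mulrCA mulrAC mulrA; set N := #|cheap h|%:R + 1.
suff NU : N <= 2 * #|uncovered h|%:R.
  rewrite ler_pdivlMr; last exact: Dpos.
  by have := ler_wpM2l (excess_ge0 h) NU; rewrite -/N; lra.
have c1 : #|cheap h|%:R <= #|uncovered h|%:R :> RR by rewrite ler_nat subset_leq_card ?finset.subsetIl.
have c2 : 1 <= #|uncovered h|%:R :> RR by rewrite ler1n lt0n.
rewrite /N; lra.
Qed.

(** Markov's inequality: at most half of the uncovered clusters cost more than [2 * theta], so at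
    least half lie in [B]. *)
Lemma excess_ratio_le h : ucost h <= theta * #|uncovered h|%:R ->
  (forall l, l \in uncovered h -> cl_cost h l <= 2 * theta -> l \in B) ->
  excess_ratio h <= 2 * theta.
Proof.
move=> uth HB; rewrite /excess_ratio ler_pdivrMr; last exact: Dpos.
have exu : excess h <= ucost h.
  apply: ler_sum => l _; rewrite ge_max cl_cost_ge0 andbT.
  by move: theta_ge0; lra.
set U := uncovered h in HB uth *.
have cardU : theta * #|U|%:R = theta * #|U :&: B|%:R + theta * #|U :\: B|%:R.
  by rewrite -mulrDr -natrD cardsID.
have big : 2 * theta * #|U :\: B|%:R <= ucost h.
  rewrite mulr_natr -sumr_const /ucost -/U [leRHS](big_setID B) /=.
  rewrite -[leLHS]add0r lerD //; first by apply: sumr_ge0 => l _; exact: cl_cost_ge0.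
  apply: ler_sum => l /finset.setDP[lU lB]; rewrite leNgt; apply: contra lB => /ltW; exact: HB.
have t0 := theta_ge0; rewrite /cheap -/U; lra.
Qed.

End Excess.

(** With [theta] and [B] frozen at [h], the ratio starts at no more than [2 * theta], whence 10 = 6
    + 2 * 2. *)
Lemma expect_avg m h : h != [::] -> (size h + m <= k)%N ->
  expect m avg h <= 10 * avg h.
Proof.
move=> h0 hm; set theta := avg h.
have t0 : 0 <= theta by rewrite divr_ge0 ?ucost_ge0.
pose B := [set l | cl_cost h l <= 2 * theta].
have ap h' : avg h' <= 6 * theta + 2 * excess_ratio theta B h'.
  exact: avg_le_excess_ratio.
apply: le_trans (expect_le ap hm) _; rewrite expect_affine //.
have small : excess_ratio theta B h <= 2 * theta.
  apply: excess_ratio_le => // [|l _]; last by rewrite inE.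
  rewrite /theta /avg; have [u0|u0] := eqVneq #|uncovered h| 0%N.
    by rewrite u0 mulr0 /ucost big_pred0 // => l; rewrite (cards0_eq u0) inE.
  by rewrite divfK // pnatr_eq0.
suff : expect m (excess_ratio theta B) h <= excess_ratio theta B h by lra.
pose I h' := h' != [::] /\ forall l, l \in B -> cl_cost h' l <= 2 * theta.
apply: (@expect_supermartingale I) => //.
- move=> h' j [h'0 H]; split=> [|l lB]; first by case: (h').
  by apply: le_trans (H l lB); exact: cl_cost_rcons.
- move=> h' [h'0 H] hk; apply: excess_ratio_step => // l /finset.setIP[_]; exact: H.
- by split=> // l; rewrite inE.
Qed.

(** * Wasted samples and the expected final cost *)

Definition harmonic m : RR := \sum_(i < m) i.+1%:R^-1.

(* With m steps left, at least [#|uncovered h| - m] (truncated) clusters stay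
   uncovered. A sample from a covered cluster may raise this number by one, hence
   the final cost by the expected final average, at most [10 * avg h] by
   expect_avg; that has probability at most [3/2 * ccost h / total h]. *)
Lemma expect_ucost m h : h != [::] -> (size h + m <= k)%N ->
  expect m ucost h <= (#|uncovered h| - m)%N%:R * expect m avg h + 15 * harmonic m * pot h.
Proof.
elim: m h => [|m IH] h h0 hm /=.
  rewrite subn0 /harmonic big_ord0 mulr0 mul0r addr0 /avg mulrC.
  have [u0|u0] := eqVneq #|uncovered h| 0%N; last by rewrite divfK // pnatr_eq0.
  by rewrite u0 mulr0 /ucost big_pred0 // => l; rewrite (cards0_eq u0) inE.
have hk : (size h < k)%N by apply: leq_trans hm; rewrite addnS ltnS leq_addr.
have hj j : (size (rcons h j) + m <= k)%N by rewrite size_rcons addSnnS.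
have rj j : rcons h j != [::] by case: (h).
set u := #|uncovered h|.
(* The charge for a hit on a covered cluster. If [u <= m], the truncated difference is 0 before and
   after, so nothing is charged. *)
pose waste l := if (l \notin uncovered h) && (m < u)%N then 10 * avg h else 0.
have harm0 : 0 <= harmonic m by apply: sumr_ge0 => i _; rewrite invr_ge0.
have avg0 : 0 <= avg h by rewrite divr_ge0 ?ucost_ge0.
apply: (@le_trans _ _ (\sum_j ((u - m.+1)%N%:R * (p h j * expect m avg (rcons h j))
          + p h j * waste (lab j) + 15 * harmonic m * (p h j * pot (rcons h j))))).
  apply: ler_sum => j _.
  apply: le_trans (ler_wpM2l (p_ge0 j hk) (IH _ (rj j) (hj j))) _.
  suff H : (#|uncovered (rcons h j)| - m)%N%:R * expect m avg (rcons h j)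
     <= (u - m.+1)%N%:R * expect m avg (rcons h j) + waste (lab j).
    by have := ler_wpM2l (p_ge0 j hk) H; lra.
  rewrite uncovered_rcons /waste; have := cardsD1 (lab j) (uncovered h); rewrite -/u.
  have [lU|lU] /= := boolP (lab j \in uncovered h) => uE.
    by rewrite addr0 uE add1n subSS.
  rewrite add0n in uE; rewrite -uE; case: ltnP => mu; last first.
    by rewrite addr0 (eqP (mu : (u - m == 0)%N)) (eqP (leqW mu : (u - m.+1 == 0)%N)).
  rewrite -(subnSK mu) -[(u - m.+1).+1]addn1 natrD mulrDl mul1r lerD2l.
  apply: le_trans (expect_avg (rj j) (hj j)) _; rewrite ler_pM2l //.
  rewrite /avg uncovered_rcons -uE ler_wpM2r ?invr_ge0 //.
  by have := ucost_rcons j h0; rewrite (negbTE lU) subr0.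
rewrite !big_split /= -!mulr_sumr -!addrA lerD2l.
have pstep := ler_wpM2l (mulr_ge0 (ler0n RR 15) harm0) (pot_step h0 hk).
have -> : harmonic m.+1 = harmonic m + m.+1%:R^-1 by rewrite /harmonic big_ord_recr.
suff W : \sum_j p h j * waste (lab j) <= 15 * (m.+1%:R^-1 * pot h).
  by rewrite (mulrDr 15) (mulrDl (15 * harmonic m)) [leLHS]addrC lerD // -mulrA.
have pot0 : 0 <= pot h by apply: le_trans (ccost_ge0 h) (ccost_le_pot h).
have im0 : 0 <= m.+1%:R^-1 :> RR by rewrite invr_ge0.
rewrite sum_by_cluster; have [mu|mu] := ltnP m u; last first.
  rewrite big1 ?mulr_ge0 // => l _.
  by rewrite /waste ltnNge mu andbF mulr0.
have [t0|t0] := eqVneq (total h) 0.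
  rewrite big1 ?mulr_ge0 // => l _; rewrite /waste /avg (total_eq0 t0).1 mul0r mulr0.
  by case: ifP; rewrite mulr0.
have [lam [lam0 lamt] mP] := mass_noise h0 hk t0.
apply: (@le_trans _ _ (3 * lam * ccost h * (10 * avg h))).
  rewrite (eq_bigr (fun l => if l \notin uncovered h then mass h l * (10 * avg h) else 0)).
    rewrite -big_mkcond /= -mulr_suml ler_wpM2r ?(mulr_ge0 _ avg0) //.
    by rewrite /ccost mulr_sumr; apply: ler_sum => l _; have /andP[] := mP l.
  by move=> l _; rewrite /waste mu andbT; case: ifP => //; rewrite mulr0.
(* This cancels the [ucost h] inside [avg h]: 3 * 10 / 2 = 15. The remaining divisor [u] is at least
   [m.+1], which gives the new harmonic term. *)
have lamu : lam * ucost h <= 1 / 2.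
  by rewrite -lamt ler_wpM2l // totalE lerDl ccost_ge0.
have iu : u%:R^-1 <= m.+1%:R^-1 :> RR.
  by rewrite lef_pV2 ?posrE ?ltr0n ?ler_nat // (leq_ltn_trans _ mu).
have iu0 : 0 <= u%:R^-1 :> RR by rewrite invr_ge0.
have c0 := ccost_ge0 h.
apply: (@le_trans _ _ (15 * (u%:R^-1 * ccost h))).
  have := ler_wpM2l (mulr_ge0 iu0 c0) lamu; rewrite /avg -/u; lra.
by rewrite ler_pM2l // ler_pM // ccost_le_pot.
Qed.

(** With enough steps to cover every cluster, the truncated difference in [expect_ucost] vanishes;
    [pot] bounds the covered cost. *)
Lemma expect_total m h : h != [::] -> (size h + m <= k)%N -> (#|uncovered h| <= m)%N ->
  expect m total h <= (1 + 15 * harmonic m) * pot h.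
Proof.
move=> h0 hm um.
have H := expect_ucost h0 hm; rewrite (eqP (um : _ == 0)%N) mul0r add0r in H.
have -> : expect m total h = expect m ucost h + expect m ccost h.
  elim: m h {h0 um H} hm => [|m IH] h hm /=; first exact: totalE.
  rewrite -big_split /=; apply: eq_bigr => j _; rewrite -mulrDr IH //.
  by rewrite size_rcons addSnnS.
have P : expect m pot h <= pot h.
  apply: (@expect_supermartingale (fun h => h != [::])) => //.
    by move=> h' j _; case: (h').
  by move=> h'; exact: pot_step.
have C := expect_le ccost_le_pot hm; lra.
Qed.

(** The first draw covers one cluster, leaving at most [k.-1] uncovered with [k.-1] steps to go, as
    [expect_total] requires. *)
Lemma exp_cost_le : (0 < k)%N -> (K <= k)%N ->
  exp_cost x p k [::] <= 48 * (1 + 15 * harmonic k.-1) * \sum_l ref_cost l.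
Proof.
move=> k0 Kk; rewrite exp_costE.
have -> : expect k total [::] = \sum_j p [::] j * expect k.-1 total [:: j].
  by rewrite -[in LHS](prednK k0).
have c0 : 0 <= 1 + 15 * harmonic k.-1.
  by rewrite addr_ge0 // mulr_ge0 // sumr_ge0 // => i _; rewrite invr_ge0.
have pot0 : pot [::] = 48 * \sum_l ref_cost l.
  rewrite /pot /ccost big_pred0 ?add0r; last by move=> l; rewrite !inE.
  by congr (_ * _); apply: eq_bigl => l; rewrite !inE.
rewrite -mulrA mulrCA -pot0.
apply: le_trans (ler_wpM2l c0 (pot_first_step k0)); rewrite mulr_sumr.
apply: ler_sum => j _; rewrite mulrCA ler_wpM2l ?p_ge0 //.
apply: expect_total => //=; first by rewrite add1n prednK.
rewrite -ltnS prednK //; apply: leq_trans Kk.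
have -> : uncovered [:: j] = [set~ lab j] by apply/setP => l; rewrite !inE.
by rewrite cardsC1 card_ord ltn_predL (leq_ltn_trans _ (ltn_ord (lab j))).
Qed.

End Process.

(** * From harmonic numbers to the logarithm and [OPT] *)

Lemma harmonic_le_ln m : harmonic m.+1 <= 1 + ln (m.+1%:R : RR).
Proof.
elim: m => [|m IH]; first by rewrite /harmonic big_ord1 invr1 ln1 addr0.
rewrite /harmonic big_ord_recr /= -/(harmonic m.+1).
have n1 : 0 < m.+1%:R :> RR by [].
have n2 : 0 < m.+2%:R :> RR by [].
have i1 : m.+2%:R^-1 < 1 :> RR by rewrite invf_lt1 // ltr1n.
(* [ln (1 + t) <= t] at [t = - m.+2%:R^-1]. *)
have : ln (m.+1%:R / m.+2%:R : RR) <= - m.+2%:R^-1.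
  have -> : m.+1%:R / m.+2%:R = 1 + - m.+2%:R^-1 :> RR.
    have -> : m.+1%:R = m.+2%:R - 1 :> RR by rewrite -[m.+2]addn1 natrD addrK.
    by rewrite mulrBl divff ?gt_eqF // mul1r.
  by apply: le_ln1Dx; rewrite ltrN2.
rewrite ln_div ?posrE //; move: IH.
by set a := harmonic _; set b := ln _; set c := ln _; set i := _^-1; lra.
Qed.

(** Clusters are the nearest-centre classes of [C], and 768 = 48 * (1 + 15). *)
Lemma exp_cost_le_phi_set (d n k : nat) (x : 'I_n -> 'rV[RR]_d) (eps : RR)
    (p : seq 'I_n -> 'I_n -> RR) (C : seq 'rV[RR]_d) :
  (0 < k)%N -> 0 <= eps -> eps < 1 / 2 -> admissible x k eps p ->
  (0 < size C)%N -> (size C <= k)%N ->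
  exp_cost x p k [::] <= 768 * (1 + ln (k%:R : RR)) * phi_set x C.
Proof.
move=> k0 eps0 eps2 adm C0 Ck.
pose ctr (l : 'I_(size C)) := nth 0 C l.
have [lab labP] : {lab : 'I_n -> 'I_(size C) &
                   forall j, phi_pt (x j) C = sqdist (x j) (ctr (lab j))}.
  apply: (@choice _ _ (fun j l => phi_pt (x j) C = sqdist (x j) (ctr l))) => j.
  have Cn : C != [::] by rewrite -size_eq0 -lt0n.
  have [c cC ->] := phi_pt_attained (x j) Cn.
  have cs : (index c C < size C)%N by rewrite index_mem.
  by exists (Ordinal cs); rewrite /ctr /= nth_index.
have -> : phi_set x C = \sum_l ref_cost x ctr lab l.
  rewrite /phi_set (partition_big lab xpredT) //=; apply: eq_bigr => l _.
  by apply: eq_bigr => j /eqP <-.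
apply: (@le_trans _ _ (48 * (1 + 15 * harmonic k.-1) * \sum_l ref_cost x ctr lab l)).
  apply: exp_cost_le => //.
  - by move=> h j hk; have [[+ _] _] := adm h hk; apply.
  - by move=> h hk; have [[_ +] _] := adm h hk.
  - move=> h h0 hk t0; have [_] := adm h hk; case: h h0 hk t0 => // i h _ _ t0 pP.
    set t := total x (i :: h) in t0.
    have tpos : 0 < t.
      by rewrite lt_neqAle eq_sym t0 sumr_ge0 // => j _; exact: phi_pt_ge0.
    exists (1 / 2 / t) => [|j].
      by split; [rewrite !divr_ge0 // ltW | rewrite divfK].
    have cj : 0 <= cost x (i :: h) j by exact: phi_pt_ge0.
    have /andP[lo hi] := pP j; rewrite -/(total x _) -/t -/(cost x _ j) in lo hi.
    have -> : 1 / 2 / t * cost x (i :: h) j = 1 / 2 * cost x (i :: h) j / t by ring.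
    have -> : 3 * (1 / 2 / t) * cost x (i :: h) j = 3 / 2 * cost x (i :: h) j / t by ring.
    by rewrite ler_pdivrMr // ler_pdivlMr //; apply/andP; split; nra.
  - move=> j; have [_ /(_ j) /andP[lo hi]] := adm [::] k0.
    apply/andP; split; [apply: le_trans lo|apply: (le_trans hi)];
      rewrite ler_wpM2r ?invr_ge0 //; lra.
have r0 : 0 <= \sum_l ref_cost x ctr lab l by apply: sumr_ge0 => l _; exact: ref_cost_ge0.
apply: ler_wpM2r => //.
have H : harmonic k.-1 <= 1 + ln (k%:R : RR).
  have := harmonic_le_ln k.-1; rewrite prednK //; apply: le_trans.
  by rewrite -[in leRHS](prednK k0) /harmonic big_ord_recr /= lerDl invr_ge0.
have L : 0 <= ln (k%:R : RR) by rewrite ln_ge0 // ler1n.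
lra.
Qed.

Theorem theorem1 :
  exists c : RR, 0 < c /\
    forall (d n k : nat) (x : 'I_n -> 'rV[RR]_d) (eps : RR)
           (p : seq 'I_n -> 'I_n -> RR),
      injective x -> (0 < n)%N -> (1 <= k)%N ->
      0 <= eps -> eps < 1 / 2 ->
      admissible x k eps p ->
      exp_cost x p k [::] <= c * (1 + ln (k%:R : RR)) * OPT x k.
Proof.
exists 768; split=> // d n k x eps p _ _ k0 eps0 eps2 adm.
have c0 : 0 < 768 * (1 + ln (k%:R : RR)).
  by rewrite mulr_gt0 // ltr_pwDl // ln_ge0 // ler1n.
(* [OPT] is an infimum, so the bound is proved for every candidate [C]; no minimiser has to be
   exhibited. *)
rewrite -ler_pdivrMl //; apply: lb_le_inf.
  by exists (phi_set x [:: 0]), [:: 0].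
move=> _ [C [C0 Ck ->]]; rewrite ler_pdivrMl //; exact: exp_cost_le_phi_set adm C0 Ck.
Qed.
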